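(* Let $A$ and $B$ be super algebras. Then any invertible $A$-$B$-bimodule $M$ is implementing.
   Context: Let $k=\mathbb{R}$ or $k=\mathbb{C}$. A super algebra is a finite-dimensional, $\mathbb{Z}_2$-graded, unital, associative $k$-algebra; $\mathrm{Aut}(A)$ denotes the Lie group of even (parity-preserving) algebra automorphisms of $A$. An $A$-$B$-bimodule is a finite-dimensional $\mathbb{Z}_2$-graded $A$-$B$-bimodule over $k$; actions are written $a\triangleright m$, $m\triangleleft b$. An $A$-$B$-bimodule $M$ is invertible if there is a $B$-$A$-bimodule $N$ with $M\otimes_B N\cong A$ and $N\otimes_A M\cong B$ via even bimodule isomorphisms. For an $A$-$B$-bimodule $M$, $I(M)$ is the group of triples $(\phi,u,\psi)$ with $\phi\in\mathrm{Aut}(A)$, $\psi\in\mathrm{Aut}(B)$ and $u:M\to M$ an even invertible linear map satisfying $u(a\triangleright m\triangleleft b)=\phi(a)\triangleright u(m)\triangleleft\psi(b)$ for all $a,m,b$. It is a closed subgroup of $\mathrm{Aut}(A)\times\mathrm{GL}(M)\times\mathrm{Aut}(B)$, hence a Lie group. $M$ is left implementing if the projection $p_\ell:I(M)\to\mathrm{Aut}(A)$ is an open map, right implementing if the projection $p_r:I(M)\to\mathrm{Aut}(B)$ is an open map, and implementing if it is both. *)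

(* Defs.v *)
From mathcomp Require Import all_boot all_order all_algebra.
From mathcomp Require Import complex.
From mathcomp Require Import all_classical all_reals all_analysis.
Import numFieldNormedType.Exports.

Set Implicit Arguments.
Unset Strict Implicit.
Unset Printing Implicit Defensive.

Import Order.TTheory GRing.Theory Num.Theory.
Local Open Scope classical_set_scope.
Local Open Scope ring_scope.

Definition grading (K : fieldType) (V : vectType K) (g : 'Z_2 -> {vspace V}) :=
  (\sum_i g i)%VS = fullv /\ directv (\sum_i g i)%VS.

Definition even_map (K : fieldType) (V W : vectType K)
    (g : 'Z_2 -> {vspace V}) (h : 'Z_2 -> {vspace W}) (f : V -> W) :=
  forall i v, v \in g i -> f v \in h i.

(* Not an extension of [falgType], which has [1 != 0] and would exclude the
   zero algebra. *)
Record superAlgebra (K : fieldType) := SuperAlgebra {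
  scar :> vectType K;
  smul : scar -> scar -> scar;
  sone : scar;
  sgr : 'Z_2 -> {vspace scar};
  smul_linearl : forall y, linear (smul^~ y);
  smul_linearr : forall x, linear (smul x);
  smulA : associative smul;
  smul1l : left_id sone smul;
  smul1r : right_id sone smul;
  sgr_grading : grading sgr;
  smul_gr : forall i j x y, x \in sgr i -> y \in sgr j -> smul x y \in sgr (i + j)
}.

Arguments smul {K A} : rename.
Arguments sone {K A} : rename.
Arguments sgr {K} A _ : rename.

Record bimodule (K : fieldType) (A B : superAlgebra K) := Bimodule {
  bcar :> vectType K;
  lact : A -> bcar -> bcar;
  ract : bcar -> B -> bcar;
  bgr : 'Z_2 -> {vspace bcar};
  lact_linearl : forall m, linear (lact^~ m);
  lact_linearr : forall a, linear (lact a);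
  lact1 : forall m, lact sone m = m;
  lactM : forall a a' m, lact (smul a a') m = lact a (lact a' m);
  ract_linearl : forall b, linear (ract^~ b);
  ract_linearr : forall m, linear (ract m);
  ract1 : forall m, ract m sone = m;
  ractM : forall m b b', ract m (smul b b') = ract (ract m b) b';
  lractA : forall a m b, ract (lact a m) b = lact a (ract m b);
  bgr_grading : grading bgr;
  lact_gr : forall i j a m, a \in sgr A i -> m \in bgr j -> lact a m \in bgr (i + j);
  ract_gr : forall i j m b, m \in bgr i -> b \in sgr B j -> ract m b \in bgr (i + j)
}.

Arguments bgr {K A B} M _ : rename.

Notation "a ▷ m" := (lact a m) (at level 40, left associativity) : ring_scope.
Notation "m ◁ b" := (ract m b) (at level 40, left associativity) : ring_scope.

Section Regular.
Variables (K : fieldType) (A : superAlgebra K).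

Definition regular_bimodule : bimodule A A :=
  @Bimodule K A A A smul smul (sgr A)
    (@smul_linearl K A) (@smul_linearr K A) (@smul1l K A)
    (fun a b c => esym (smulA a b c))
    (@smul_linearl K A) (@smul_linearr K A) (@smul1r K A)
    (@smulA K A) (fun a b c => esym (smulA a b c))
    (@sgr_grading K A) (@smul_gr K A) (@smul_gr K A).

End Regular.

Definition bimodule_iso (K : fieldType) (A B : superAlgebra K)
    (M N : bimodule A B) :=
  exists f : 'Hom(M, N),
    [/\ bijective f, even_map (bgr M) (bgr N) f
      & forall a m b, f (a ▷ m ◁ b) = a ▷ f m ◁ b].

Definition balanced (K : fieldType) (A B C : superAlgebra K)
    (M : bimodule A B) (N : bimodule B C) (W : vectType K) (t : M -> N -> W) :=
  [/\ forall n, linear (t^~ n), forall m, linear (t m)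
    & forall m b n, t (m ◁ b) n = t m (b ▷ n)].

(* [T], with [t] as [m, n |-> m (x) n], is the tensor product [M (x)_B N]:
   the universal balanced map out of [M * N], with
   [a ▷ (m (x) n) ◁ c = (a ▷ m) (x) (n ◁ c)] and
   [M_i (x) N_j] in degree [i + j]. *)
Definition is_tensor (K : fieldType) (A B C : superAlgebra K)
    (M : bimodule A B) (N : bimodule B C) (T : bimodule A C)
    (t : M -> N -> T) :=
  [/\ balanced t,
      forall (W : vectType K) (s : M -> N -> W), balanced s ->
        exists! f : 'Hom(T, W), forall m n, f (t m n) = s m n,
      forall a m n c, a ▷ t m n ◁ c = t (a ▷ m) (n ◁ c)
    & forall i j m n, m \in bgr M i -> n \in bgr N j -> t m n \in bgr T (i + j)].

Definition tensor_iso (K : fieldType) (A B C : superAlgebra K)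
    (M : bimodule A B) (N : bimodule B C) (P : bimodule A C) :=
  exists (T : bimodule A C) (t : M -> N -> T),
    is_tensor t /\ bimodule_iso T P.

Definition invertible_bimodule (K : fieldType) (A B : superAlgebra K)
    (M : bimodule A B) :=
  exists N : bimodule B A,
    tensor_iso M N (regular_bimodule A) /\ tensor_iso N M (regular_bimodule B).

(* The topology of ['M[K]_(dim V)], which does not depend on the basis of [V]
   chosen by its [vectType] structure. *)
Definition topEnd (K : numFieldType) (V : vectType K) : topologicalType :=
  initial_topology (fun f : 'End(V) => VectorInternalTheory.f2mx f).

(* Used below as topological spaces: a set coerces to the type of its elements,
   which carries the subspace topology. *)
Definition GL (K : numFieldType) (V : vectType K) : set (topEnd V) :=
  [set f : 'End(V) | bijective f].
Arguments GL {K} V _.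

Definition Aut (K : numFieldType) (A : superAlgebra K) : set (topEnd A) :=
  [set f : 'End(A) | [/\ bijective f, f sone = sone, {morph f : x y / smul x y}
                       & even_map (sgr A) (sgr A) f]].
Arguments Aut {K} A _.

Section Implementing.
Variables (K : numFieldType) (A B : superAlgebra K) (M : bimodule A B).

Definition implementers : set (Aut A * GL M * Aut B)%type :=
  [set x | let phi : 'End(A) := val x.1.1 in
           let u : 'End(M) := val x.1.2 in
           let psi : 'End(B) := val x.2 in
           even_map (bgr M) (bgr M) u /\
           forall a m b, u (a ▷ m ◁ b) = phi a ▷ u m ◁ psi b].

Definition pl (x : implementers) : Aut A := (val x).1.1.
Definition pr (x : implementers) : Aut B := (val x).2.

Definition left_implementing :=
  forall U : set implementers, open U -> open (pl @` U).
Definition right_implementing :=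
  forall U : set implementers, open U -> open (pr @` U).
Definition implementing := left_implementing /\ right_implementing.

End Implementing.

Arguments implementers {K A B} M _.

(* Main.v *)
From HB Require Import structures.
Require Import Defs.
From mathcomp Require Import all_boot all_order all_algebra.
From mathcomp Require Import complex.
From mathcomp Require Import all_classical all_reals all_analysis.
Import numFieldNormedType.Exports.

Set Implicit Arguments.
Unset Strict Implicit.
Unset Printing Implicit Defensive.

Import Order.TTheory GRing.Theory Num.Theory.
Import VectorInternalTheory.
Local Open Scope classical_set_scope.
Local Open Scope ring_scope.

(** The projection [pl] is open because it has local sections through every
    point of [I(M)], and these sections are given by an explicit formula.

    Let [N] be an inverse of [M]. The isomorphisms [M (x) N = A] and
    [N (x) M = B], the second one corrected by a bimodule automorphism of [M],
    yield pairings [s : M * N -> A] and [t : N * M -> B] with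
    [s x n ▷ y = x ◁ t n y] ([invertible_morita_context]). Writing the unit of
    [B] as [\sum_j t (y_j) (e_j)] turns them into a finite dual basis of the
    left [A]-module [M]: [m = \sum_j f_j m ▷ e_j] with [f_j m = s m (y_j)].

    Let [(phi0, u0, psi0)] be in [I(M)]. For an even automorphism [phi] of [A]
    the map [m |-> \sum_j phi (f_j m) ▷ u0 e_j] is [phi]-semilinear, depends
    linearly on [phi], and is [u0] when [phi = phi0]. Its even part [u] has the
    same three properties, so [u] is bijective for [phi] near [phi0]. The maps
    [m |-> u (u^-1 m ◁ b)] commute with [A]; since the dual basis shows that
    [A]-linear endomorphisms of [M] are right multiplications by a unique
    element of [B], this determines an automorphism [psi] of [B] with
    [(phi, u, psi)] in [I(M)]. As [psi] is given by a formula in [u] and [u^-1],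
    it varies continuously with [phi] and is [psi0] at [phi0]
    ([implements_lift]).

    The pairings keep their properties when [M] is viewed as a bimodule over the
    opposite algebras ([morita_context_opposite]), and this exchanges [pl] and
    [pr]; the unit of [A], written through [s], then gives the statement for
    [pr]. *)

(** * Linear maps in coordinates *)

Section Coordinates.
Variable K : fieldType.
Implicit Types V W : vectType K.

Lemma v2r_lfun V W (u : 'Hom(V, W)) x : v2r (u x) = v2r x *m f2mx u.
Proof. by rewrite unlock /= r2vK. Qed.

Lemma f2mx_row V W (u : 'Hom(V, W)) i j :
  f2mx u i j = v2r (u (r2v (delta_mx 0 i))) 0 j.
Proof. by rewrite v2r_lfun r2vK -rowE mxE. Qed.

Lemma bijective_f2mx V (u : 'End(V)) : bijective u <-> f2mx u \in unitmx.
Proof.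
split=> [bu|Uu].
  rewrite -row_free_unit; apply: inj_row_free => r r0.
  have /(bij_inj bu) : u (r2v r) = u 0.
    by apply: v2r_inj; rewrite !v2r_lfun r2vK r0 linear0 mul0mx.
  by move=> /(congr1 v2r); rewrite r2vK linear0.
exists (fun x => r2v (v2r x *m invmx (f2mx u))) => x.
  by rewrite v2r_lfun mulmxK // v2rK.
by apply: v2r_inj; rewrite v2r_lfun r2vK mulmxKV.
Qed.

Lemma lfunK V (u : 'End(V)) : bijective u -> cancel u (u^-1)%VF.
Proof. by move=> /bij_inj/lker0P; exact: lker0_lfunK. Qed.

Lemma lfunVK V (u : 'End(V)) : bijective u -> cancel (u^-1)%VF u.
Proof. by move=> /bij_inj/lker0P; exact: lker0_lfunVK. Qed.

Lemma injective_bijective V (u : 'End(V)) : injective u -> bijective u.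
Proof.
move=> /lker0P u0; exists (u^-1)%VF; first exact: lker0_lfunK.
exact: lker0_lfunVK.
Qed.

(** For functions whose linearity is a hypothesis, such as the two actions on a
    bimodule, rather than a canonical structure. *)
Lemma linear_lfun V W (f : V -> W) : linear f -> linfun f =1 f.
Proof.
move=> lf; pose g : {linear V -> W} :=
  HB.pack f (GRing.isLinear.Build K V W _ f lf).
exact: (lfunE g).
Qed.

Lemma linear_sum_of V W (f : V -> W)
    (I : finType) (x : I -> V) :
  linear f -> f (\sum_i x i) = \sum_i f (x i).
Proof.
move=> lf; rewrite -(linear_lfun lf) linear_sum.
by apply: eq_bigr => i _; exact: linear_lfun.
Qed.

End Coordinates.

(** * Convergence of vectors and of linear maps *)

(** The topology of [topEnd V] is that of matrices, so convergence of vectors and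
    of linear maps is expressed coordinatewise, relative to the basis that
    [v2r] provides. *)

Section MatrixConvergence.
Variables (K : numFieldType) (T : Type) (F : set_system T).
Context {FF : Filter F}.

Lemma cvg_mxP (m n : nat) (f : T -> 'M[K]_(m, n)) (A : 'M[K]_(m, n)) :
  f @ F --> A <-> forall i j, f t i j @[t --> F] --> A i j.
Proof.
split=> [fA i j P AP|fA P [Q AQ QP]].
  apply: (fA [set B | P (B i j)]).
  exists (fun i' j' => [set x | i' = i -> j' = j -> P x]) => [i' j'|B PB].
    case: (pselect (i' = i /\ j' = j)) => [[-> ->]|ne].
      by apply: filterS AP => x Px.
    by apply: filterE => x /= ei ej; case: ne.
  exact: PB.
rewrite /= nbhs_simpl.
have /filterS : F [set t | forall ij : 'I_m * 'I_n, Q ij.1 ij.2 (f t ij.1 ij.2)].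
  by apply: filter_forall => -[i j]; exact: fA (AQ i j).
by apply=> t Qt; apply: QP => i j; exact: (Qt (i, j)).
Qed.

Lemma cvg_det n (f : T -> 'M[K]_n) (A : 'M[K]_n) :
  (forall i j, f t i j @[t --> F] --> A i j) ->
  \det (f t) @[t --> F] --> \det A.
Proof.
move=> fA; rewrite /determinant.
apply: cvg_big => [|s _]; first exact: add_continuous.
apply: cvgM; first exact: cvg_cst.
by apply: cvg_big => [|i _]; first exact: mul_continuous.
Qed.

End MatrixConvergence.

Section VectorConvergence.
Variables (K : numFieldType) (T : Type) (F : set_system T).
Context {FF : Filter F}.
Implicit Types V W : vectType K.

Definition vec_cvg V (x : T -> V) (x0 : V) :=
  forall i, v2r (x t) 0 i @[t --> F] --> v2r x0 0 i.

Definition map_cvg V W (u : T -> 'Hom(V, W)) (u0 : 'Hom(V, W)) :=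
  forall i j, f2mx (u t) i j @[t --> F] --> f2mx u0 i j.

Lemma vec_cvg_cst V (x : V) : vec_cvg (fun=> x) x.
Proof. by move=> i; exact: cvg_cst. Qed.

Lemma map_cvg_cst V W (u : 'Hom(V, W)) : map_cvg (fun=> u) u.
Proof. by move=> i j; exact: cvg_cst. Qed.

Lemma vec_cvg_sum V (I : finType) (x : I -> T -> V) x0 :
  (forall i, vec_cvg (x i) (x0 i)) ->
  vec_cvg (fun t => \sum_i x i t) (\sum_i x0 i).
Proof.
move=> xx0 j; rewrite linear_sum summxE.
under eq_cvg do rewrite linear_sum summxE.
by apply: cvg_big => [|i _]; [exact: add_continuous | exact: xx0].
Qed.

Lemma vec_cvg_app V W (u : T -> 'Hom(V, W)) (u0 : 'Hom(V, W)) x x0 :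
  map_cvg u u0 -> vec_cvg x x0 -> vec_cvg (fun t => u t (x t)) (u0 x0).
Proof.
move=> uu0 xx0 j; rewrite v2r_lfun mxE.
under eq_cvg do rewrite v2r_lfun mxE.
by apply: cvg_big => [|i _]; [exact: add_continuous | exact: cvgM].
Qed.

(** Row [i] of the matrix of [u] is the image under [u] of the [i]-th basis
    vector. *)
Lemma map_cvg_pointwise V W (u : T -> 'Hom(V, W)) (u0 : 'Hom(V, W)) :
  (forall x, vec_cvg (u^~ x) (u0 x)) -> map_cvg u u0.
Proof.
move=> uu0 i j; rewrite f2mx_row.
by under eq_cvg do rewrite f2mx_row; exact: uu0.
Qed.

(** Bijectivity is an open condition: a determinant does not vanish. *)
Lemma near_bijective V (u : T -> 'End(V)) (u0 : 'End(V)) :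
  bijective u0 -> map_cvg u u0 -> \forall t \near F, bijective (u t).
Proof.
move=> /bijective_f2mx; rewrite unitmxE unitfE => d0 /cvg_det du.
have dt0 : \forall t \near F, \det (f2mx (u t)) != 0 by exact: cvgr_neq0 du d0.
by apply: filterS dt0 => t dt; apply/bijective_f2mx; rewrite unitmxE unitfE.
Qed.

(** By Cramer's rule the entries of the inverse are rational functions of the
    entries of [u]. *)
Lemma map_cvg_inv V (u : T -> 'End(V)) (u0 : 'End(V)) :
  bijective u0 -> map_cvg u u0 -> map_cvg (fun t => (u t)^-1)%VF (u0^-1)%VF.
Proof.
move=> bu0 uu0 i j.
have inv_f2mx (v : 'End(V)) : bijective v ->
    f2mx (v^-1)%VF i j = (\det (f2mx v))^-1 * cofactor (f2mx v) j i.
  move=> /bijective_f2mx Uv.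
  by rewrite /= pinvmxE // /invmx Uv mxE [in X in _ * X]mxE.
have det0 : \det (f2mx u0) != 0.
  by rewrite -unitfE -unitmxE; exact/bijective_f2mx.
have cofu : cofactor (f2mx (u t)) j i @[t --> F] --> cofactor (f2mx u0) j i.
  apply: cvgM; first exact: cvg_cst.
  apply: (@cvg_det _ _ _ _ _ (fun t => row' j (col' i (f2mx (u t))))) => a b.
  by under eq_cvg do rewrite !mxE; rewrite !mxE; exact: uu0.
rewrite inv_f2mx //; apply: cvg_trans (cvgM (cvgV det0 (cvg_det uu0)) cofu).
apply: near_eq_cvg; apply: filterS (near_bijective bu0 uu0) => t bt.
by rewrite inv_f2mx.
Qed.

Lemma cvg_topEndP V (u : T -> topEnd V) (u0 : topEnd V) :
  u @ F --> u0 <-> @map_cvg V V u u0.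
Proof.
rewrite /map_cvg -cvg_mxP; split=> [uu0|uu0 P].
  apply: cvg_comp uu0 _.
  exact: (@initial_continuous 'End(V) 'M[K]_(dim V) (@f2mx _ V V) u0).
case=> _ [[D oD <-] Du0 DP].
apply: (filterS (P := fun t => D (f2mx (u t)))) => [t Dt|]; first exact: DP.
by apply: uu0; exact: open_nbhs_nbhs.
Qed.

End VectorConvergence.

(** * Gradings *)

Section Gradings.
Variable K : fieldType.
Implicit Types V W : vectType K.

Definition gproj V (g : 'Z_2 -> {vspace V}) (i : 'Z_2) : 'End(V) :=
  sumv_pi (\sum_i g i)%VS i.

Lemma gproj_mem V (g : 'Z_2 -> {vspace V}) i x : gproj g i x \in g i.
Proof. exact: memv_sum_pi. Qed.

Lemma gproj_sum V (g : 'Z_2 -> {vspace V}) x :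
  grading g -> \sum_i gproj g i x = x.
Proof. by case=> gV _; apply: sumv_pi_sum; rewrite gV memvf. Qed.

Lemma gproj_unique V (g : 'Z_2 -> {vspace V}) (w : 'Z_2 -> V) i :
  grading g -> (forall j, w j \in g j) -> gproj g i (\sum_j w j) = w i.
Proof.
move=> gg wg; have [_ /directv_sum_unique dg] := gg.
have := dg (gproj g ^~ (\sum_j w j)) w (fun j _ => gproj_mem g j _)
  (fun j _ => wg j).
by rewrite gproj_sum // eqxx => /esym/forall_inP/(_ i isT)/eqP.
Qed.

Lemma gproj_homogeneous V (g : 'Z_2 -> {vspace V}) i j x :
  grading g -> x \in g j -> gproj g i x = if i == j then x else 0.
Proof.
move=> gg xj.
have {1}-> : x = \sum_k (if k == j then x else 0).
  by rewrite -big_mkcond big_pred1_eq.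
by rewrite gproj_unique // => k; case: eqP => [->|_] //; exact: mem0v.
Qed.

(** Applied to the actions on bimodules: acting by a homogeneous element of
    degree [d] shifts the homogeneous components by [d]. *)
Lemma gproj_shift V W (g : 'Z_2 -> {vspace V}) (h : 'Z_2 -> {vspace W}) d
    (f : V -> W) : grading g -> grading h -> linear f ->
  (forall j x, x \in g j -> f x \in h (j + d)) ->
  forall i x, gproj h i (f x) = f (gproj g (i - d) x).
Proof.
move=> gg hh lf fd i x; rewrite -{1}(gproj_sum x gg) (linear_sum_of _ lf).
rewrite (reindex_inj (addIr (- d))) /=.
rewrite (gproj_unique (w := fun j => f (gproj g (j - d) x))) // => j.
by rewrite -{2}(subrK d j) fd // gproj_mem.
Qed.

Lemma gproj_even V W (g : 'Z_2 -> {vspace V}) (h : 'Z_2 -> {vspace W})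
    (f : 'Hom(V, W)) : grading g -> grading h ->
  even_map g h f <-> (forall i x, gproj h i (f x) = f (gproj g i x)).
Proof.
move=> gg hh; split=> [fe i x|fe i x xi].
  rewrite (@gproj_shift _ _ g h 0) ?subr0 //; first exact: linearP.
  by move=> j y; rewrite addr0; exact: fe.
suff -> : f x = gproj h i (f x) by exact: gproj_mem.
by rewrite fe (gproj_homogeneous _ gg xi) eqxx.
Qed.

Definition even_part V (g : 'Z_2 -> {vspace V}) (u : 'End(V)) : 'End(V) :=
  \sum_i (gproj g i \o u \o gproj g i)%VF.

Lemma even_partE V (g : 'Z_2 -> {vspace V}) (u : 'End(V)) x :
  even_part g u x = \sum_i gproj g i (u (gproj g i x)).
Proof. by rewrite sum_lfunE; apply: eq_bigr => i _; rewrite !lfunE /= lfunE. Qed.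

Lemma even_part_even V (g : 'Z_2 -> {vspace V}) (u : 'End(V)) :
  grading g -> even_map g g (even_part g u).
Proof.
move=> gg i x xi; rewrite even_partE (bigD1 i) //= big1 ?addr0 ?gproj_mem //.
by move=> j ji; rewrite (gproj_homogeneous _ gg xi) (negPf ji) !linear0.
Qed.

Lemma even_part_id V (g : 'Z_2 -> {vspace V}) (u : 'End(V)) :
  grading g -> even_map g g u -> even_part g u = u.
Proof.
move=> gg /(gproj_even _ gg gg) ue; apply/lfunP => x; rewrite even_partE.
under eq_bigr do rewrite ue (gproj_homogeneous _ gg (gproj_mem _ _ _)) eqxx.
by rewrite -linear_sum gproj_sum.
Qed.

End Gradings.

Section Linearity.
Variables (K : fieldType) (A B : superAlgebra K) (M : bimodule A B).

Lemma lact_suml (I : finType) (a : I -> A) (m : M) :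
  (\sum_i a i) ▷ m = \sum_i a i ▷ m.
Proof. exact: (linear_sum_of _ (@lact_linearl _ _ _ M m)). Qed.

Lemma lact_sumr (I : finType) a (m : I -> M) :
  a ▷ (\sum_i m i) = \sum_i a ▷ m i.
Proof. exact: (linear_sum_of _ (@lact_linearr _ _ _ M a)). Qed.

Lemma ract_suml (I : finType) (m : I -> M) b :
  (\sum_i m i) ◁ b = \sum_i m i ◁ b.
Proof. exact: (linear_sum_of _ (@ract_linearl _ _ _ M b)). Qed.

Lemma ract_sumr (I : finType) (m : M) b :
  m ◁ (\sum_(i : I) b i) = \sum_i m ◁ b i.
Proof. exact: (linear_sum_of _ (@ract_linearr _ _ _ M m)). Qed.

Lemma smul_suml (I : finType) (a : I -> A) c :
  smul (\sum_i a i) c = \sum_i smul (a i) c.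
Proof. exact: (linear_sum_of _ (@smul_linearl _ A c)). Qed.

Lemma smul_sumr (I : finType) (a : I -> A) c :
  smul c (\sum_i a i) = \sum_i smul c (a i).
Proof. exact: (linear_sum_of _ (@smul_linearr _ A c)). Qed.

End Linearity.

(** * Dual bases and twisted automorphisms of a bimodule *)

(** The maps [f j] and the vectors [e j] form a finite dual basis of [M] as a left
    [A]-module (see [frame_expansion]). The maps [g j] record that the
    endomorphisms [f j x ▷ _] of [M] come from [B]; this is what identifies [B]
    with the [A]-linear endomorphisms of [M]. *)
Definition dual_frame (K : fieldType) (A B : superAlgebra K) (M : bimodule A B)
    n (f : 'I_n -> 'Hom(M, A)) (g : 'I_n -> 'Hom(M, B)) (e : 'I_n -> M) :=
  [/\ forall j a m, f j (a ▷ m) = smul a (f j m),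
      forall j m b, g j (m ◁ b) = smul (g j m) b,
      forall j x y, f j x ▷ y = x ◁ g j y
    & \sum_j g j (e j) = sone].

Section GradedActions.
Variables (K : fieldType) (A B : superAlgebra K) (M : bimodule A B).

Lemma gproj_lact i j a (m : M) : a \in sgr A j ->
  gproj (bgr M) i (a ▷ m) = a ▷ gproj (bgr M) (i - j) m.
Proof.
move=> aj; apply: (gproj_shift (bgr_grading M) (bgr_grading M)).
  exact: lact_linearr.
by move=> k x xk; rewrite addrC; exact: lact_gr.
Qed.

Lemma gproj_ract i j (m : M) b : m \in bgr M j ->
  gproj (bgr M) i (m ◁ b) = m ◁ gproj (sgr B) (i - j) b.
Proof.
move=> mj; apply: (gproj_shift (sgr_grading B) (bgr_grading M)).
  exact: ract_linearr.
by move=> k x xk; rewrite addrC; exact: ract_gr.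
Qed.

End GradedActions.

Section DualFrames.
Variables (K : fieldType) (A B : superAlgebra K) (M : bimodule A B).

Definition twisted (phi : 'End(A)) (u : 'End(M)) :=
  forall a m, u (a ▷ m) = phi a ▷ u m.

Lemma twisted_even_part (phi : 'End(A)) (u : 'End(M)) : even_map (sgr A) (sgr A) phi ->
  twisted phi u -> twisted phi (even_part (bgr M) u).
Proof.
move=> phie uphi a m; rewrite -(gproj_sum a (sgr_grading A)).
rewrite lact_suml linear_sum [phi _]linear_sum lact_suml.
apply: eq_bigr => j _; set aj := gproj _ _ _.
have aAj : aj \in sgr A j := gproj_mem _ _ _.
rewrite /= !even_partE lact_sumr [RHS](reindex_inj (addIr (- j))) /=.
apply: eq_bigr => i _.
by rewrite (gproj_lact _ _ aAj) uphi (gproj_lact _ _ (phie _ _ aAj)).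
Qed.

Variables (n : nat) (f : 'I_n -> 'Hom(M, A)) (g : 'I_n -> 'Hom(M, B)).
Variables (e : 'I_n -> M) (frame : dual_frame f g e).

Lemma frame_expansion m : \sum_j f j m ▷ e j = m.
Proof.
have [_ _ fg ge1] := frame.
under eq_bigr do rewrite fg.
by rewrite -ract_sumr ge1 ract1.
Qed.

Lemma frame_coef b : \sum_j g j (e j ◁ b) = b.
Proof.
have [_ gB _ ge1] := frame.
under eq_bigr do rewrite gB.
by rewrite -smul_suml ge1 smul1l.
Qed.

Lemma frame_faithful b c : (forall m : M, m ◁ b = m ◁ c) -> b = c.
Proof.
move=> bc; rewrite -[b]frame_coef -[c]frame_coef.
by apply: eq_bigr => j _; rewrite bc.
Qed.

(** Expanding [m] along the dual basis, [v m] is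
    [\sum_j f j m ▷ v (e j) = \sum_j m ◁ g j (v (e j))]. *)
Lemma frame_centralizer (v : 'End(M)) : (forall a m, v (a ▷ m) = a ▷ v m) ->
  forall m, v m = m ◁ \sum_j g j (v (e j)).
Proof.
have [_ _ fg _] := frame => vA m.
rewrite -{1}(frame_expansion m) linear_sum ract_sumr.
by apply: eq_bigr => j _; rewrite /= vA fg.
Qed.

Definition conj_ract (u : 'End(M)) (b : B) : 'End(M) :=
  (u \o linfun (fun m => m ◁ b) \o u^-1)%VF.

(** The formula of [frame_centralizer] for the [A]-linear map [conj_ract u b]. *)
Definition induced (u : 'End(M)) : 'End(B) :=
  linfun (fun b => \sum_j g j (u ((u^-1)%VF (e j) ◁ b))).

Lemma inducedE (u : 'End(M)) b :
  induced u b = \sum_j g j (u ((u^-1)%VF (e j) ◁ b)).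
Proof.
apply: linear_lfun => c x y; rewrite scaler_sumr -big_split /=.
by apply: eq_bigr => j _; rewrite ract_linearr !linearP.
Qed.

Lemma inducedP (phi : 'End(A)) (u : 'End(M)) :
    bijective phi -> bijective u -> twisted phi u ->
  forall m b, u (m ◁ b) = u m ◁ induced u b.
Proof.
move=> bphi bu uphi m b.
have conjE x : conj_ract u b x = u ((u^-1)%VF x ◁ b).
  by rewrite !lfunE /= lfunE /= linear_lfun //; exact: ract_linearl.
have conjA a x : conj_ract u b (a ▷ x) = a ▷ conj_ract u b x.
  rewrite !conjE; case: bphi => phi' _ phiK; rewrite -(phiK a).
  by rewrite -{1}(lfunVK bu x) -uphi lfunK // lractA uphi.
have := frame_centralizer conjA (u m).
rewrite conjE lfunK // inducedE => ->; congr (_ ◁ _).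
by apply: eq_bigr => j _; rewrite conjE.
Qed.

(** Substituting [phi] into the dual basis expansion
    [u0 m = \sum_j phi0 (f j m) ▷ u0 (e j)] of a [phi0]-semilinear [u0] deforms it
    into a [phi]-semilinear map. *)
Definition frame_map (u0 : 'End(M)) (phi : 'End(A)) : 'End(M) :=
  linfun (fun m => \sum_j phi (f j m) ▷ u0 (e j)).

Lemma frame_mapE (u0 : 'End(M)) (phi : 'End(A)) m :
  frame_map u0 phi m = \sum_j phi (f j m) ▷ u0 (e j).
Proof.
apply: linear_lfun => c x y; rewrite scaler_sumr -big_split /=.
by apply: eq_bigr => j _; rewrite !linearP lact_linearl.
Qed.

Lemma twisted_frame_map (u0 : 'End(M)) (phi : 'End(A)) :
  {morph phi : x y / smul x y} -> twisted phi (frame_map u0 phi).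
Proof.
have [fA _ _ _] := frame => phiM a m; rewrite !frame_mapE lact_sumr.
by apply: eq_bigr => j _; rewrite fA phiM lactM.
Qed.

Lemma frame_map_id (u0 : 'End(M)) (phi : 'End(A)) :
  twisted phi u0 -> frame_map u0 phi = u0.
Proof.
move=> uphi; apply/lfunP => m; rewrite frame_mapE -{2}(frame_expansion m).
by rewrite linear_sum; apply: eq_bigr => j _; rewrite /= uphi.
Qed.

End DualFrames.

Section Lifting.
Variables (K : numFieldType) (A B : superAlgebra K) (M : bimodule A B).

Definition implements (phi : 'End(A)) (u : 'End(M)) (psi : 'End(B)) :=
  [/\ Aut A phi, Aut B psi, GL M u, even_map (bgr M) (bgr M) u
    & forall a m b, u (a ▷ m ◁ b) = phi a ▷ u m ◁ psi b].

Variables (n : nat) (f : 'I_n -> 'Hom(M, A)) (g : 'I_n -> 'Hom(M, B)).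
Variables (e : 'I_n -> M) (frame : dual_frame f g e).

(** All properties of [psi := induced g e u] follow from
    [u (m ◁ b) = u m ◁ psi b] because [M] is faithful over [B]. *)
Lemma implements_induced (phi : 'End(A)) (u : 'End(M)) :
    Aut A phi -> bijective u -> even_map (bgr M) (bgr M) u -> twisted phi u ->
  implements phi u (induced g e u).
Proof.
move=> Aphi bu ue uphi.
have [bphi phi1 phiM phie] := Aphi.
have uB := inducedP frame bphi bu uphi.
split=> //; last by move=> a m b; rewrite uB uphi.
have faithful b c : (forall m : M, u m ◁ b = u m ◁ c) -> b = c.
  by move=> bc; apply: (frame_faithful frame) => m; rewrite -(lfunVK bu m).
split.
- apply: injective_bijective => b c bc; apply: (frame_faithful frame) => m.
  by apply: (bij_inj bu); rewrite !uB bc.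
- by apply: faithful => m; rewrite -uB !ract1.
- by move=> b c; apply: faithful => m; rewrite ractM -!uB ractM.
- apply/(gproj_even _ (sgr_grading B) (sgr_grading B)) => i b.
  (* For m of degree k both u m ◁ psi (b_i) and u m ◁ (psi b)_i are the
     component of degree i + k of u (m ◁ b). *)
  apply: faithful => m; rewrite -(gproj_sum m (bgr_grading M)) linear_sum.
  rewrite !ract_suml; apply: eq_bigr => k _ /=.
  have mk := gproj_mem (bgr M) k m.
  rewrite -uB -{1}(addrK k i) -(gproj_ract _ _ (ue _ _ mk)) -uB.
  rewrite ((gproj_even _ (bgr_grading M) (bgr_grading M)).1 ue).
  by rewrite (gproj_ract _ _ mk) addrK.
Qed.

(** Since [psi] is determined by [u], a family lifting [phi] whose middle term
    converges to [u0] also converges to [psi0] in the last term. *)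
Lemma implements_unique (phi : 'End(A)) (u : 'End(M)) (psi : 'End(B)) :
  implements phi u psi -> psi = induced g e u.
Proof.
case=> -[_ phi1 _ _] _ bu _ uphi; apply/lfunP => b; rewrite inducedE.
rewrite -{1}(frame_coef frame (psi b)); apply: eq_bigr => j _.
by rewrite -[X in u (X ◁ b)]lact1 uphi phi1 lact1 lfunVK.
Qed.

(** The local section of [pl], read along an arbitrary family [phi] converging to
    [phi0]. *)
Lemma implements_lift (T : Type) (F : set_system T) {FF : Filter F}
    (phi : T -> 'End(A)) phi0 u0 psi0 :
    (forall t, Aut A (phi t)) -> map_cvg F phi phi0 -> implements phi0 u0 psi0 ->
  exists (u : T -> 'End(M)) (psi : T -> 'End(B)),
    [/\ map_cvg F u u0, map_cvg F psi psi0
      & \forall t \near F, implements (phi t) (u t) (psi t)].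
Proof.
move=> Aphi phi_cvg impl0; have [_ _ bu0 u0e impl0E] := impl0.
have gM := bgr_grading M.
pose u t := even_part (bgr M) (frame_map f e u0 (phi t)).
have uphi0 : twisted phi0 u0.
  have [_ [_ psi1 _ _] _ _ _] := impl0.
  by move=> a m; rewrite -[a ▷ m]ract1 impl0E psi1 ract1.
have u_cvg : map_cvg F u u0.
  have <- : even_part (bgr M) (frame_map f e u0 phi0) = u0.
    by rewrite (frame_map_id frame) // even_part_id.
  apply: map_cvg_pointwise => m; rewrite even_partE /u.
  under eq_fun do rewrite even_partE.
  apply: vec_cvg_sum => i; apply: vec_cvg_app; first exact: map_cvg_cst.
  rewrite frame_mapE; under eq_fun do rewrite frame_mapE.
  apply: vec_cvg_sum => j.
  have actE a : a ▷ u0 (e j) = linfun (fun a => a ▷ u0 (e j)) a.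
    by rewrite linear_lfun //; exact: lact_linearl.
  rewrite actE; under eq_fun do rewrite actE.
  apply: vec_cvg_app; first exact: map_cvg_cst.
  by apply: vec_cvg_app phi_cvg _; exact: vec_cvg_cst.
exists u, (fun t => induced g e (u t)); split=> //.
- rewrite (implements_unique impl0); apply: map_cvg_pointwise => b.
  rewrite inducedE; under eq_fun do rewrite inducedE.
  apply: vec_cvg_sum => j; apply: vec_cvg_app; first exact: map_cvg_cst.
  apply: vec_cvg_app => //.
  have actE m : m ◁ b = linfun (fun m : M => m ◁ b) m.
    by rewrite linear_lfun //; exact: ract_linearl.
  rewrite actE; under eq_fun do rewrite actE.
  apply: vec_cvg_app; first exact: map_cvg_cst.
  by apply: (vec_cvg_app (map_cvg_inv bu0 u_cvg)); exact: vec_cvg_cst.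
- apply: filterS (near_bijective bu0 u_cvg) => t but.
  have [_ _ phiM phie] := Aphi t.
  apply: implements_induced => //; first exact: even_part_even.
  by apply: twisted_even_part => //; exact: (twisted_frame_map frame).
Qed.

End Lifting.

(** * Opposite algebras and bimodules *)

Section Opposite.
Variables (K : fieldType) (A B : superAlgebra K) (M : bimodule A B).

Lemma opposite_smul_gr (C : superAlgebra K) i j (x y : C) :
  x \in sgr C i -> y \in sgr C j -> smul y x \in sgr C (i + j).
Proof. by move=> xi yj; rewrite addrC; exact: smul_gr. Qed.

Definition opposite_algebra (C : superAlgebra K) : superAlgebra K :=
  @SuperAlgebra K C (fun x y => smul y x) sone (sgr C)
    (@smul_linearr K C) (@smul_linearl K C)
    (fun x y z => esym (smulA z y x)) (@smul1r K C) (@smul1l K C)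
    (@sgr_grading K C) (@opposite_smul_gr C).

Lemma opposite_lact_gr i j (b : B) (m : M) :
  b \in sgr B i -> m \in bgr M j -> m ◁ b \in bgr M (i + j).
Proof. by move=> bi mj; rewrite addrC; exact: ract_gr. Qed.

Lemma opposite_ract_gr i j (m : M) (a : A) :
  m \in bgr M i -> a \in sgr A j -> a ▷ m \in bgr M (i + j).
Proof. by move=> mi aj; rewrite addrC; exact: lact_gr. Qed.

Definition opposite_bimodule :
    bimodule (opposite_algebra B) (opposite_algebra A) :=
  @Bimodule K (opposite_algebra B) (opposite_algebra A) M
    (fun b m => @ract K A B M m b) (fun m a => @lact K A B M a m) (bgr M)
    (@ract_linearr K A B M) (@ract_linearl K A B M) (@ract1 K A B M)
    (fun b b' m => @ractM K A B M m b' b)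
    (@lact_linearr K A B M) (@lact_linearl K A B M) (@lact1 K A B M)
    (fun m a a' => @lactM K A B M a' a m)
    (fun b m a => esym (@lractA K A B M a m b))
    (@bgr_grading K A B M) opposite_lact_gr opposite_ract_gr.

End Opposite.

(** * Pairings from invertibility *)

Section MoritaContexts.
Variable K : fieldType.

(** One half of a Morita context. Only the dependence on [M] matters for dual
    bases, so [N] is a bare index type. *)
Definition morita_context (A B : superAlgebra K) (M : bimodule A B) (N : Type)
    (s : M -> N -> A) (t : N -> M -> B) :=
  [/\ (forall n, linear (s^~ n)) /\ (forall n, linear (t n)),
      forall a m n, s (a ▷ m) n = smul a (s m n),
      forall n m b, t n (m ◁ b) = smul (t n m) b
    & forall x n y, s x n ▷ y = x ◁ t n y].

Lemma morita_context_opposite (A B : superAlgebra K) (M : bimodule A B)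
    (N : Type) (s : M -> N -> A) (t : N -> M -> B) : morita_context s t ->
  @morita_context _ _ (opposite_bimodule M) N (fun m n => t n m) (fun n m => s m n).
Proof.
case=> -[sl tl] sA tB st; split=> // [b m n|n m a|x n y].
- exact: tB.
- exact: sA.
- exact: esym (st y n x).
Qed.

Lemma morita_context_frame (A B : superAlgebra K) (M : bimodule A B)
    (N : Type) (s : M -> N -> A) (t : N -> M -> B) n (y : 'I_n -> N) e :
    morita_context s t -> \sum_j t (y j) (e j) = sone ->
  dual_frame (fun j => linfun (s^~ (y j))) (fun j => linfun (t (y j))) e.
Proof.
case=> -[sl tl] sA tB st te.
have lE j m : linfun (s^~ (y j)) m = s m (y j) by rewrite linear_lfun.
have rE j m : linfun (t (y j)) m = t (y j) m by rewrite linear_lfun.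
split=> [j a m|j m b|j x m|]; rewrite ?lE ?rE //.
by under eq_bigr do rewrite rE.
Qed.

End MoritaContexts.

Section Tensor.
Variables (K : fieldType) (A B C : superAlgebra K).
Variables (M : bimodule A B) (N : bimodule B C).

Lemma balanced_span (W : vectType K) (s : M -> N -> W) m n : balanced s ->
  s m n \in <<[seq s x y | x <- vbasis {:M}, y <- vbasis {:N}]>>%VS.
Proof.
case=> sl sr _.
rewrite (coord_vbasis (memvf m)) (coord_vbasis (memvf n)).
rewrite (linear_sum_of _ (sl _)); apply: memv_suml => i _.
rewrite (linear_sum_of _ (sr _)); apply: memv_suml => j _.
have lE x y : linfun (s x) y = s x y by rewrite linear_lfun.
have rE x y : linfun (s^~ y) x = s x y by rewrite linear_lfun.
rewrite -lE linearZ /= lE memvZ // -rE linearZ /= rE memvZ //.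
by apply: memv_span; apply: allpairs_f; apply: mem_nth; rewrite size_tuple.
Qed.

(** The projection onto the span of the pure tensors fixes all pure tensors, so
    by the uniqueness part of the universal property it is the identity. *)
Lemma tensor_span (T : bimodule A C) (t : M -> N -> T) (z : T) : is_tensor t ->
  exists k (x : 'I_k -> M) (y : 'I_k -> N), z = \sum_i t (x i) (y i).
Proof.
case=> t_bal t_univ _ _.
pose X := [seq t x y | x <- vbasis {:M}, y <- vbasis {:N}].
have zX : z \in <<in_tuple X>>%VS.
  have [f [_ f_unique]] := t_univ _ _ t_bal.
  have projt m n : projv <<X>> (t m n) = t m n by rewrite projv_id // balanced_span.
  have <- : projv <<X>> z = z.
    rewrite -(f_unique _ projt) (f_unique \1%VF) => [|m n]; by rewrite lfunE.
  exact: memv_proj.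
have /choice[xy xyE] (i : 'I_(size X)) : exists p, X`_i = t p.1 p.2.
  by have /allpairsP[p [_ _ ->]] : X`_i \in X; [exact: mem_nth | exists p].
exists (size X), (fun i => coord (in_tuple X) i z *: (xy i).1), (fun i => (xy i).2).
rewrite {1}(coord_span zX); apply: eq_bigr => i _.
have [tl _ _] := t_bal.
by rewrite -(linear_lfun (tl _)) linearZ /= (linear_lfun (tl _)) -xyE.
Qed.

(** The universal property of the tensor product, transported to [P]. *)
Lemma tensor_iso_pairing (P : bimodule A C) : tensor_iso M N P ->
  exists t : M -> N -> P,
  [/\ balanced t,
      forall (W : vectType K) (s : M -> N -> W), balanced s ->
        exists h : 'Hom(P, W), forall m n, h (t m n) = s m n,
      forall a m n, t (a ▷ m) n = a ▷ t m n,
      forall m n c, t m (n ◁ c) = t m n ◁ c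
    & forall z, exists k (x : 'I_k -> M) (y : 'I_k -> N), z = \sum_i t (x i) (y i)].
Proof.
case=> T [t [t_tensor [f [f_bij _ fE]]]].
have [[tl tr tb] t_univ tE _] := t_tensor.
exists (fun m n => f (t m n)); split.
- split=> [n c x y|m c x y|m b n]; first by rewrite tl linearP.
    by rewrite tr linearP.
  by rewrite tb.
- move=> W s /t_univ[h [hE _]]; exists (h \o f^-1)%VF => m n.
  rewrite lfunE /= -hE; congr (h _).
  by apply: lker0_lfunK; apply/lker0P; exact: bij_inj.
- by move=> a m n; rewrite -[RHS]ract1 -fE tE ract1.
- by move=> m n c; rewrite -[f (t m n)]lact1 -fE tE lact1.
- move=> z; case: f_bij => f' _ f'K.
  have [k [x [y zE]]] := tensor_span (f' z) t_tensor.
  by exists k, x, y; rewrite -(f'K z) zE linear_sum.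
Qed.

End Tensor.

Section Morita.
Variables (K : fieldType) (A B : superAlgebra K) (M : bimodule A B).

(** The pairings [s] and [t] obtained from the two isomorphisms need not satisfy
    [s m n ▷ z = m ◁ t n z]: they do so only up to the bimodule automorphism
    [theta] of [M] that compares the two maps [M (x) N (x) M -> M]. Replacing [t]
    by [t n (theta^-1 m)] repairs this. *)
Lemma invertible_morita_context : invertible_bimodule M ->
  exists (N : Type) (s : M -> N -> A) (t : N -> M -> B),
  [/\ morita_context s t,
      exists k (x : 'I_k -> M) (y : 'I_k -> N), \sum_j s (x j) (y j) = sone
    & exists k (y : 'I_k -> N) (x : 'I_k -> M), \sum_j t (y j) (x j) = sone].
Proof.
case=> N [/tensor_iso_pairing[s [[sl sr sb] s_univ sA sC s_span]]].
case/tensor_iso_pairing=> t [[tl tr tb] t_univ tB tC t_span].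
have [k [x [y s1]]] := s_span sone.
have [l [y' [x' t1]]] := t_span sone.
(* The image of 1 (x) m under x (x) n (x) z |-> x ◁ t n z, with 1 in
   A = M (x) N. *)
pose theta := linfun (fun m => \sum_i x i ◁ t (y i) m).
have thetaE m : theta m = \sum_i x i ◁ t (y i) m.
  apply: linear_lfun => c u v; rewrite scaler_sumr -big_split /=.
  by apply: eq_bigr => i _; rewrite tr ract_linearr.
have assoc m n z : s m n ▷ theta z = m ◁ t n z.
  have bal : balanced (fun (m : M) (n : N) => m ◁ t n z).
    split=> [n'|m' c u v|m' b n']; first exact: ract_linearl.
      by rewrite tl ract_linearr.
    by rewrite -ractM tB.
  (* For fixed z, m ◁ t n z is a function h of s m n, and h is A-linear. *)
  have [h hE] := s_univ _ _ bal.
  rewrite -hE -[s m n in RHS]smul1r s1 smul_sumr linear_sum thetaE lact_sumr.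
  by apply: eq_bigr => i _; rewrite -lractA -hE sA.
have theta_inj : injective theta.
  suff theta0 z : theta z = 0 -> z = 0.
    move=> u v uv; apply/eqP; rewrite -subr_eq0; apply/eqP/theta0.
    by rewrite linearB /= uv subrr.
  move=> z0.
  have tz0 n : t n z = 0.
    rewrite -[t n z]smul1l t1 smul_suml big1 // => j _.
    rewrite -[smul _ _]tC -assoc z0.
    rewrite -(linear_lfun (@lact_linearr _ _ _ M _)) linear0.
    by rewrite -(linear_lfun (tr _)) linear0.
  (* s m n ▷ z is in turn a function of t n z. *)
  rewrite -[z]lact1 s1 lact_suml big1 // => i _.
  have bal : balanced (fun (n : N) (z : M) => s (x i) n ▷ z).
    split=> [z' c u v|n|n a z']; [|exact: lact_linearr|].
      by rewrite sr lact_linearl.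
    by rewrite -lactM sC.
  by have [h hE] := t_univ _ _ bal; rewrite -hE tz0 linear0.
have theta_bij := injective_bijective theta_inj.
have thetaK := lfunK theta_bij; have thetaVK := lfunVK theta_bij.
exists N, s, (fun n m => t n ((theta^-1)%VF m)); split.
- split=> //.
  + by split=> // n c u v; rewrite linearP tr.
  + move=> n m b; rewrite -[RHS]tC; congr (t n _).
    apply: theta_inj; rewrite thetaVK thetaE.
    under eq_bigr do rewrite tC ractM.
    by rewrite -ract_suml -thetaE thetaVK.
  + by move=> m n z; rewrite -assoc thetaVK.
- by exists k, x, y.
- exists l, y', (fun j => theta (x' j)); rewrite t1.
  by apply: eq_bigr => j _; rewrite thetaK.
Qed.

End Morita.

(** * Openness of the projections *)

Lemma open_map_of_local_sections (X Y : topologicalType) (p : X -> Y) :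
    (forall x, exists s : Y -> X,
      s y @[y --> p x] --> x /\ \forall y \near p x, p (s y) = y) ->
  forall U, open U -> open (p @` U).
Proof.
move=> p_sec U oU; rewrite openE => _ [x Ux <-].
have [s [sx ps]] := p_sec x.
have sU : \forall y \near p x, U (s y) by exact: sx (open_nbhs_nbhs (conj oU Ux)).
by near=> y; exists (s y); near: y.
Unshelve. all: by end_near. Qed.

Lemma cvg_set_type (T : Type) (F : set_system T) {FF : Filter F}
    (X : topologicalType) (D : set X) (s : T -> D) (x : D) :
  set_val (s t) @[t --> F] --> set_val x -> s @ F --> x.
Proof.
move=> sx P; case=> _ [[U oU <-] Ux UP].
have FU : F (fun t => U (set_val (s t))) by apply: sx; apply: open_nbhs_nbhs.
suff : F (s @^-1` P) by [].
by apply: filterS FU => t Ut; exact: UP.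
Qed.

Section ImplementerSections.
Variables (K : numFieldType) (A B : superAlgebra K) (M : bimodule A B).

Lemma implementsP (x : implementers M) :
  implements (set_val (pl x)) (set_val (set_val x).1.2) (set_val (pr x)).
Proof.
have [ue uE] : implementers M (set_val x) := set_valP x.
by split=> //; exact: set_valP.
Qed.

Lemma implements_implementer phi u psi : @implements K A B M phi u psi ->
  exists x : implementers M,
    [/\ set_val (pl x) = phi, set_val (set_val x).1.2 = u & set_val (pr x) = psi].
Proof.
case=> Aphi Apsi GLu ue uE.
pose x : (Aut A * GL M * Aut B)%type :=
  (exist (fun y => y \in Aut A) phi (mem_set Aphi),
   exist (fun y => y \in GL M) u (mem_set GLu),
   exist (fun y => y \in Aut B) psi (mem_set Apsi)).
have Ix : implementers M x by [].
by exists (exist (fun y => y \in implementers M) x (mem_set Ix)).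
Qed.

(** Convergence of the three components of a triple is convergence in
    [implementers M]; where the triple is not an implementer, [s] takes the
    value [x]. *)
Lemma implementers_cvg (T : Type) (F : set_system T) {FF : Filter F}
    (phi : T -> 'End(A)) (u : T -> 'End(M)) (psi : T -> 'End(B))
    (x : implementers M) :
    map_cvg F phi (set_val (pl x)) -> map_cvg F u (set_val (set_val x).1.2) ->
    map_cvg F psi (set_val (pr x)) ->
    (\forall t \near F, implements (phi t) (u t) (psi t)) ->
  exists s : T -> implementers M, s @ F --> x /\
    \forall t \near F, set_val (pl (s t)) = phi t /\ set_val (pr (s t)) = psi t.
Proof.
move=> phix ux psix impl.
have /choice[s sE] t : exists y : implementers M,
    implements (phi t) (u t) (psi t) ->
    [/\ set_val (pl y) = phi t, set_val (set_val y).1.2 = u t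
      & set_val (pr y) = psi t].
  have [/implements_implementer[y yE]|nimpl] :=
    pselect (implements (phi t) (u t) (psi t)); first by exists y.
  by exists x.
exists s; split; last by apply: filterS impl => t /sE[].
have near_cvg (V : vectType K) (f g : T -> topEnd V) (f0 : topEnd V) :
    @map_cvg _ _ F V V f f0 -> (\forall t \near F, g t = f t) -> g @ F --> f0.
  move=> /cvg_topEndP ff0 gf; apply: cvg_trans ff0; apply: near_eq_cvg.
  by apply: filterS gf => t ->.
apply: cvg_set_type.
have phi_cvg : pl (s t) @[t --> F] --> pl x.
  apply: cvg_set_type; apply: near_cvg phix _.
  by apply: filterS impl => t /sE[].
have u_cvg : (set_val (s t)).1.2 @[t --> F] --> (set_val x).1.2.
  apply: cvg_set_type; apply: near_cvg ux _.
  by apply: filterS impl => t /sE[].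
have psi_cvg : pr (s t) @[t --> F] --> pr x.
  apply: cvg_set_type; apply: near_cvg psix _.
  by apply: filterS impl => t /sE[].
have pairE (y : Aut A * GL M * Aut B) : y = ((y.1.1, y.1.2), y.2).
  by case: y => -[].
rewrite [set_val x]pairE; under eq_fun do rewrite [set_val _]pairE.
exact: cvg_pair (cvg_pair phi_cvg u_cvg) psi_cvg.
Qed.

Lemma map_cvg_val (V : vectType K) (D : set (topEnd V)) (x : D) :
  @map_cvg K D (nbhs x) V V set_val (set_val x).
Proof. by apply/cvg_topEndP; exact: initial_continuous. Qed.

Lemma left_implementing_of_frame n (f : 'I_n -> 'Hom(M, A))
    (g : 'I_n -> 'Hom(M, B)) (e : 'I_n -> M) :
  dual_frame f g e -> left_implementing M.
Proof.
move=> frame; apply: open_map_of_local_sections => x.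
have [u [psi [ux psix impl]]] := implements_lift frame
  (fun y => set_valP y) (map_cvg_val (x := pl x)) (implementsP x).
have [s [sx sE]] := implementers_cvg (map_cvg_val (x := pl x)) ux psix impl.
exists s; split=> //; apply: filterS sE => y [sy _].
by apply: val_inj; rewrite set_valE in sy.
Qed.

Lemma Aut_opposite (C : superAlgebra K) (phi : 'End(C)) :
  Aut (opposite_algebra C) phi <-> Aut C phi.
Proof.
by split=> -[? ? phiM ?]; split=> // x y; rewrite [LHS]phiM.
Qed.

Lemma implements_opposite phi u psi :
  @implements K A B M phi u psi <->
  @implements K _ _ (opposite_bimodule M) psi u phi.
Proof.
split=> -[Aphi Apsi GLu ue uE].
  split=> //; [exact/Aut_opposite|exact/Aut_opposite|].
  by move=> b m a; rewrite /= -lractA uE lractA.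
split=> //; [exact/Aut_opposite|exact/Aut_opposite|].
by move=> a m b; rewrite !lractA; exact: uE b m a.
Qed.

Lemma right_implementing_of_frame n
    (f : 'I_n -> 'Hom(opposite_bimodule M, opposite_algebra B))
    (g : 'I_n -> 'Hom(opposite_bimodule M, opposite_algebra A))
    (e : 'I_n -> opposite_bimodule M) :
  dual_frame f g e -> right_implementing M.
Proof.
move=> frame; apply: open_map_of_local_sections => x.
have Aut_op (y : Aut B) : Aut (opposite_algebra B) (set_val y).
  by apply/Aut_opposite; exact: set_valP.
have [u [phi [ux phix impl]]] := implements_lift frame
  Aut_op (map_cvg_val (x := pr x)) ((implements_opposite _ _ _).1 (implementsP x)).
have {}impl : \forall y \near pr x, @implements K A B M (phi y) (u y) (set_val y).
  by apply: filterS impl => y /implements_opposite.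
have [s [sx sE]] := implementers_cvg phix ux (map_cvg_val (x := pr x)) impl.
exists s; split=> //; apply: filterS sE => y [_ sy].
by apply: val_inj; rewrite set_valE in sy.
Qed.

End ImplementerSections.

Theorem proposition3p1p7 (R : realType) (K : numFieldType)
    (hK : K = R :> numFieldType \/ K = R[i]%C :> numFieldType)
    (A B : superAlgebra K) (M : bimodule A B) :
  invertible_bimodule M -> implementing M.
Proof.
case/invertible_morita_context=> N [s [t [ctx [k [x [y s1]]] [l [y' [x' t1]]]]]].
split.
- exact: left_implementing_of_frame (morita_context_frame ctx t1).
- exact: right_implementing_of_frame
    (morita_context_frame (morita_context_opposite ctx) s1).
Qed.
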